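(* Let $F,G,B$ be $m\times m$ matrices over $\mathcal F$ with $\det F=0$ and $sF-G$ a regular pencil, and let $J_p,H_q,B_p,B_q$ be the matrices obtained from the Weierstrass decomposition of $sF-G$. Consider the system $FX_{k+1}=GX_k+BV_k$ ($k=0,1,2,\dots$), written in the coordinates $Y_k=Q^{-1}X_k=\begin{bmatrix}Y^p_k\\ Y^q_k\end{bmatrix}$ as the pair of subsystems $$Y^p_{k+1}=J_pY^p_k+B_pV_k,\qquad H_qY^q_{k+1}=Y^q_k+B_qV_k .$$ Then the set $\Re(\bar 0)$ of states reachable from the zero initial condition $Y_0=\bar 0$ is $$\Re(\bar 0)=\bar S_p(J_p/B_p)\oplus \bar S_{q^*}(H_q/B_q),$$ where $q^*$ is the index of annihilation of $H_q$.
   Context: Setting. $\mathcal F$ is a field containing the finite eigenvalues of the pencil $sF-G$ (e.g. $\mathcal F=\mathbb C$), $\mathcal M_{m1}=\mathcal F^{m\times 1}$, and $X_k,V_k\in\mathcal M_{m1}$ are the state and input at time $k$. The pencil $sF-G$ is regular, i.e. $\det(sF-G)\not\equiv 0$. By the Weierstrass canonical form there are nonsingular $m\times m$ matrices $P,Q$ and integers $p+q=m$ with $$PFQ=\mathrm{blockdiag}(I_p,H_q),\qquad PGQ=\mathrm{blockdiag}(J_p,I_q),$$ where $J_p$ is a $p\times p$ Jordan matrix (whose diagonal entries are the finite eigenvalues of the pencil) and $H_q$ is a $q\times q$ block diagonal matrix whose blocks are nilpotent Jordan blocks (ones on the first superdiagonal, zeros elsewhere). The index of annihilation $q^*$ is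 the least positive integer with $H_q^{q^*}=0$. Write $PB=\begin{bmatrix}B_p\\ B_q\end{bmatrix}$ with $B_p$ of size $p\times m$ and $B_q$ of size $q\times m$. Reachability. A vector $W\in\mathcal M_{m1}$ is reachable from an initial condition $Y_0$ if there is a sequence of inputs $V_0,V_1,V_2,\dots$ and a corresponding solution of the system starting at $Y_0$ such that $Y_k=W$ for some $k\ge 0$. $\Re(Y_0)$ denotes the set of all vectors reachable from $Y_0$, and $\bar 0$ denotes a zero vector. Subspaces. For $i,j\ge1$, $$S_i(J_p/B_p)=\mathrm{colspan}\,[\,B_p\ \ J_pB_p\ \cdots\ J_p^{i-1}B_p\,]\subseteq\mathcal F^{p},\qquad S_j(H_q/B_q)=\mathrm{colspan}\,[\,B_q\ \ H_qB_q\ \cdots\ H_q^{j-1}B_q\,]\subseteq\mathcal F^{q},$$ and $$\bar S_p(J_p/B_p)=\left\{\begin{bmatrix}y_1\\ \bar 0\end{bmatrix}\in\mathcal M_{m1}: y_1\in S_p(J_p/B_p)\right\},\qquad \bar S_{q^*}(H_q/B_q)=\left\{\begin{bmatrix}\bar 0\\ y_2\end{bmatrix}\in\mathcal M_{m1}: y_2\in S_{q^*}(H_q/B_q)\right\}.$$ *)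

(* Defs.v *)
From HB Require Import structures.
From mathcomp Require Import all_boot all_order all_algebra.

Set Implicit Arguments.
Unset Strict Implicit.
Unset Printing Implicit Defensive.

Import GRing.Theory.
Local Open Scope ring_scope.

Definition regular_pencil (K : fieldType) (m : nat) (F G : 'M[K]_m) : Prop :=
  \det ('X *: map_mx polyC F - map_mx polyC G) != 0.

Definition jordan_block (K : fieldType) (n : nat) (a : K) : 'M[K]_n :=
  \matrix_(i, j) (a *+ (i == j :> nat) + 1 *+ (i.+1 == j :> nat)).

(* The cast identifies the total size \sum_i sz i of the blocks with n. *)
Definition is_block_jordan (K : fieldType) (n k : nat) (sz : 'I_k -> nat)
    (a : 'I_k -> K) (M : 'M[K]_n) : Prop :=
  (forall i, 0 < sz i)%N /\
  exists e : (\sum_(i < k) sz i)%N = n,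
    M = castmx (e, e) (\mxdiag_(i < k) jordan_block (sz i) (a i)).

Definition is_jordan (K : fieldType) (n : nat) (M : 'M[K]_n) : Prop :=
  exists (k : nat) (sz : 'I_k -> nat) (a : 'I_k -> K), is_block_jordan sz a M.

Definition is_nilpotent_jordan (K : fieldType) (n : nat) (M : 'M[K]_n) : Prop :=
  exists (k : nat) (sz : 'I_k -> nat), is_block_jordan sz (fun=> 0) M.

Record weierstrass_form (K : fieldType) (p q : nat)
    (F G P Q : 'M[K]_(p + q)) (J : 'M[K]_p) (H : 'M[K]_q) : Prop := {
  weierstrass_unitP : P \in unitmx;
  weierstrass_unitQ : Q \in unitmx;
  weierstrass_jordan : is_jordan J;
  weierstrass_nilpotent : is_nilpotent_jordan H;
  weierstrass_F : P *m F *m Q = block_mx 1%:M 0 0 H;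
  weierstrass_G : P *m G *m Q = block_mx J 0 0 1%:M }.

Definition index_of_annihilation (K : fieldType) (q : nat) (H : 'M[K]_q)
    (qs : nat) : Prop :=
  [/\ (0 < qs)%N, H ^+ qs = 0
    & forall j : nat, (0 < j)%N -> H ^+ j = 0 -> (qs <= j)%N].

Definition descriptor_solution (K : fieldType) (m : nat) (F G B : 'M[K]_m)
    (V X : nat -> 'cV[K]_m) : Prop :=
  forall k : nat, F *m X k.+1 = G *m X k + B *m V k.

Definition subsystems_solution (K : fieldType) (p q : nat)
    (J : 'M[K]_p) (H : 'M[K]_q)
    (Bp : 'M[K]_(p, p + q)) (Bq : 'M[K]_(q, p + q))
    (V Y : nat -> 'cV[K]_(p + q)) : Prop :=
  forall k : nat,
    usubmx (Y k.+1) = J *m usubmx (Y k) + Bp *m V k /\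
    H *m dsubmx (Y k.+1) = dsubmx (Y k) + Bq *m V k.

Definition reachable (K : fieldType) (p q : nat)
    (J : 'M[K]_p) (H : 'M[K]_q)
    (Bp : 'M[K]_(p, p + q)) (Bq : 'M[K]_(q, p + q))
    (Y0 W : 'cV[K]_(p + q)) : Prop :=
  exists V Y : nat -> 'cV[K]_(p + q),
    [/\ subsystems_solution J H Bp Bq V Y, Y 0%N = Y0
      & exists k : nat, Y k = W].

Definition colspan (K : fieldType) (m n : nat) (M : 'M[K]_(m, n)) :
    {vspace 'cV[K]_m} :=
  <<[seq col j M | j <- enum 'I_n]>>%VS.

(* S_i(A/B), the column space of [B  AB  ...  A^(i-1) B] *)
Definition krylov_space (K : fieldType) (n m : nat) (A : 'M[K]_n)
    (B : 'M[K]_(n, m)) (i : nat) : {vspace 'cV[K]_n} :=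
  colspan (\mxrow_(k < i) (A ^+ k *m B)).

Definition embed_top (K : fieldType) (p q : nat) (y : 'cV[K]_p) :
    'cV[K]_(p + q) := col_mx y 0.

Definition embed_bottom (K : fieldType) (p q : nat) (y : 'cV[K]_q) :
    'cV[K]_(p + q) := col_mx 0 y.

(* linfun f agrees with f only when f is linear, hence these instances. *)
Fact embed_top_is_linear (K : fieldType) (p q : nat) :
  linear (@embed_top K p q).
Proof.
by move=> a u v; rewrite /embed_top scale_col_mx add_col_mx scaler0 addr0.
Qed.

Fact embed_bottom_is_linear (K : fieldType) (p q : nat) :
  linear (@embed_bottom K p q).
Proof.
by move=> a u v; rewrite /embed_bottom scale_col_mx add_col_mx scaler0 addr0.
Qed.

HB.instance Definition _ (K : fieldType) (p q : nat) :=
  GRing.isLinear.Build K 'cV[K]_p 'cV[K]_(p + q) _ (@embed_top K p q)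
    (@embed_top_is_linear K p q).

HB.instance Definition _ (K : fieldType) (p q : nat) :=
  GRing.isLinear.Build K 'cV[K]_q 'cV[K]_(p + q) _ (@embed_bottom K p q)
    (@embed_bottom_is_linear K p q).

Definition top_space (K : fieldType) (p q : nat) (U : {vspace 'cV[K]_p}) :
    {vspace 'cV[K]_(p + q)} :=
  (linfun (@embed_top K p q) @: U)%VS.

Definition bottom_space (K : fieldType) (p q : nat) (U : {vspace 'cV[K]_q}) :
    {vspace 'cV[K]_(p + q)} :=
  (linfun (@embed_bottom K p q) @: U)%VS.

(* Main.v *)
Require Import Defs.
From mathcomp Require Import all_boot all_order all_algebra.

Set Implicit Arguments.
Unset Strict Implicit.
Unset Printing Implicit Defensive.

Import GRing.Theory.

Local Open Scope ring_scope.

(** The two subsystems evolve in opposite directions of time.  The slow one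
    accumulates past inputs from the initial state 0,
      Y^p_k = sum_(i < k) J^i Bp V_(k-1-i)           ([forward_recurrence]),
    so it always lies in a Krylov space, and by Cayley-Hamilton in the one of
    length p ([krylov_space_max]).  The fast one is solved by iterating
    its equation until H^d = 0 eliminates the later state, which exhibits the
    state as a function of present and future inputs only,
      Y^q_k = - sum_(i < d) H^i Bq V_(k+i)           ([backward_recurrence]),
    so it lies in the Krylov space of length d.  This proves one inclusion.

    For the other one, the input is cut into three consecutive windows: d
    zeros, then p inputs that steer the slow state to its target, and finally,
    from time k = d + p on, the inputs that produce the fast target at time k.
    The windows do not interfere: the slow state at time k ignores the inputs
    from time k on, and the fast state at time k ignores those before k.  The
    leading zeros are what makes the trajectory start at 0, because the fast
    state at time 0 is not free but determined by the first d inputs. *)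

(** * Column spaces and Krylov spaces *)

Lemma colspanE (K : fieldType) (m n : nat) (M : 'M[K]_(m, n)) :
  colspan M = limg (linfun (mulmx M)).
Proof.
apply/eqP; rewrite eqEsubv; apply/andP; split.
  apply/span_subvP => _ /mapP[j _ ->].
  by rewrite colE -[_ *m _](lfunE (mulmx M)) memv_img ?memvf.
apply/subvP => _ /memv_imgP[c _ ->]; rewrite lfunE /=.
have -> : M *m c = \sum_j c j 0 *: col j M.
  apply/colP => i; rewrite mxE summxE; apply: eq_bigr => j _.
  by rewrite !mxE mulrC.
apply: memv_suml => j _; apply/memvZ/memv_span/map_f.
by rewrite mem_enum.
Qed.

(** The coefficient vectors are indexed by all of nat so that windows of an
    input sequence can be used as they are. *)
Lemma krylov_spaceP (K : fieldType) (n m : nat) (A : 'M[K]_n)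
    (B : 'M[K]_(n, m)) (k : nat) (x : 'cV[K]_n) :
  reflect (exists u : nat -> 'cV[K]_m,
             x = \sum_(i < k) A ^+ i *m (B *m u i))
          (x \in krylov_space A B k).
Proof.
rewrite /krylov_space colspanE; apply: (iffP memv_imgP) => [[c _ ->]|[u ->]].
  exists (fun i => if insub i is Some j then submxcol c j else 0).
  rewrite lfunE /= -{1}[c]submxcolK mul_mxrow_mxcol.
  by apply: eq_bigr => i _; rewrite valK mulmxA.
exists (\mxcol_(i < k) u i); first exact: memvf.
rewrite lfunE /= mul_mxrow_mxcol.
by apply: eq_bigr => i _; rewrite mulmxA.
Qed.

(** Euclidean division of X^k by the characteristic polynomial, evaluated at A
    with Cayley-Hamilton. *)
Lemma expmx_lin_comb (K : fieldType) (n : nat) (A : 'M[K]_n) (k : nat) :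
  exists c : nat -> K, A ^+ k = \sum_(i < n) c i *: A ^+ i.
Proof.
case: n A => [|n] A.
  by exists (fun=> 0); rewrite [LHS]flatmx0 [RHS]flatmx0.
set r := 'X^k %% char_poly A.
have size_r : (size r <= n.+1)%N.
  by rewrite -ltnS -(size_char_poly A) ltn_modp monic_neq0 ?char_poly_monic.
exists (fun i => r`_i).
rewrite -[A in LHS]horner_mx_X -rmorphXn /= (divp_eq 'X^k (char_poly A)) -/r.
rewrite rmorphD rmorphM /= Cayley_Hamilton mulr0 add0r.
rewrite [in LHS](_ : r = \poly_(i < n.+1) r`_i); last first.
  apply/polyP => i; rewrite coef_poly; case: ltnP => // le_n_i.
  by rewrite nth_default // (leq_trans size_r).
rewrite poly_def raddf_sum; apply: eq_bigr => i _ /=.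
by rewrite linearZ /= rmorphXn /= horner_mx_X.
Qed.

Lemma krylov_space_max (K : fieldType) (n m : nat) (A : 'M[K]_n)
    (B : 'M[K]_(n, m)) (k : nat) :
  (krylov_space A B k <= krylov_space A B n)%VS.
Proof.
apply/subvP => _ /krylov_spaceP[u ->]; apply: memv_suml => i _.
have [c ->] := expmx_lin_comb A i.
apply/krylov_spaceP; exists (fun j => c j *: u i).
rewrite mulmx_suml; apply: eq_bigr => j _.
by rewrite -scalemxAl -!scalemxAr.
Qed.

(** * Explicit solutions of the two subsystems *)

(** Both directions at once: the formula solves the recurrence, and a sequence
    given by a recurrence and its initial value is unique. *)
Lemma forward_recurrence (K : fieldType) (n m : nat) (A : 'M[K]_n)
    (B : 'M[K]_(n, m)) (v : nat -> 'cV[K]_m) (x : nat -> 'cV[K]_n) :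
  (x 0%N = 0 /\ forall k, x k.+1 = A *m x k + B *m v k) <->
  (forall k, x k = \sum_(i < k) A ^+ i *m (B *m v (k - i.+1)%N)).
Proof.
pose s k := \sum_(i < k) A ^+ i *m (B *m v (k - i.+1)%N).
have s0 : s 0%N = 0 by rewrite /s big_ord0.
have sS k : s k.+1 = A *m s k + B *m v k.
  rewrite /s big_ord_recl /= expr0 mul1mx subn1 addrC mulmx_sumr.
  by congr (_ + _); apply: eq_bigr => i _; rewrite exprS -mulmxE -mulmxA.
split=> [[x0 xS] k | xE].
  by rewrite -/(s k); elim: k => [|k IHk]; rewrite ?x0 ?s0 // xS sS IHk.
by split=> [|k]; rewrite !xE; [exact: s0 | exact: sS].
Qed.

(** Iterating H x_(k+1) = x_k + B v_k from k upwards gives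
    x_k = H^d x_(k+d) - sum_(i < d) H^i B v_(k+i), and H^d kills the unknown
    later state.  Hence the trajectory, initial value included, is a function
    of the input. *)
Lemma backward_recurrence (K : fieldType) (n m d : nat) (H : 'M[K]_n)
    (B : 'M[K]_(n, m)) (v : nat -> 'cV[K]_m) (x : nat -> 'cV[K]_n) :
  H ^+ d = 0 ->
  (forall k, H *m x k.+1 = x k + B *m v k) <->
  (forall k, x k = - \sum_(i < d) H ^+ i *m (B *m v (k + i)%N)).
Proof.
move=> Hd0; split=> [xS k | xE k].
  suff iter_xS j :
      x k = H ^+ j *m x (k + j)%N
            - \sum_(i < j) H ^+ i *m (B *m v (k + i)%N).
    by rewrite (iter_xS d) Hd0 mul0mx add0r.
  elim: j => [|j IHj]; first by rewrite big_ord0 expr0 mul1mx addn0 subr0.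
  rewrite big_ord_recr /= exprSr -mulmxE -mulmxA addnS xS mulmxDr opprD.
  by rewrite addrACA subrr addr0.
(* Shifting the sum by one leaves the top term H^d, which vanishes. *)
have shift : \sum_(i < d.+1) H ^+ i *m (B *m v (k + i)%N)
             = \sum_(i < d) H ^+ i *m (B *m v (k + i)%N).
  by rewrite big_ord_recr /= Hd0 mul0mx addr0.
rewrite !xE mulmxN -shift big_ord_recl /= expr0 mul1mx addn0 opprD.
rewrite addrAC addNr add0r mulmx_sumr; congr (- _).
by apply: eq_bigr => i _; rewrite exprS -mulmxE -mulmxA addSnnS.
Qed.

(** * Decoupling and the direct sum *)

Lemma descriptor_solution_decoupled (K : fieldType) (p q : nat)
    (F G B P Q : 'M[K]_(p + q)) (J : 'M[K]_p) (H : 'M[K]_q)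
    (V X : nat -> 'cV[K]_(p + q)) :
  weierstrass_form F G P Q J H ->
  descriptor_solution F G B V X <->
  subsystems_solution J H (usubmx (P *m B)) (dsubmx (P *m B)) V
    (fun k => invmx Q *m X k).
Proof.
case=> unitP unitQ _ _ PFQ PGQ.
pose Y k := invmx Q *m X k.
have PF k : P *m (F *m X k) = col_mx (usubmx (Y k)) (H *m dsubmx (Y k)).
  have -> : P *m (F *m X k) = P *m F *m Q *m Y k by rewrite /Y !mulmxA mulmxK.
  by rewrite PFQ -{1}[Y k]vsubmxK mul_block_col mul1mx !mul0mx addr0 add0r.
have PG k : P *m (G *m X k + B *m V k) =
    col_mx (J *m usubmx (Y k) + usubmx (P *m B) *m V k)
           (dsubmx (Y k) + dsubmx (P *m B) *m V k).
  have -> : P *m (G *m X k + B *m V k) = P *m G *m Q *m Y k + P *m B *m V k.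
    by rewrite mulmxDr /Y !mulmxA mulmxK.
  rewrite PGQ -{1}[Y k]vsubmxK -{1}[P *m B]vsubmxK mul_block_col mul_col_mx.
  by rewrite mul1mx !mul0mx addr0 add0r add_col_mx.
split=> sol k.
  by apply: eq_col_mx; rewrite -PF -PG sol.
apply: (can_inj (mulKmx unitP)); rewrite PF PG.
by case: (sol k) => -> ->.
Qed.

Lemma top_spaceP (K : fieldType) (p q : nat) (U : {vspace 'cV[K]_p})
    (x : 'cV[K]_(p + q)) :
  reflect (exists2 y, y \in U & x = col_mx y 0) (x \in top_space q U).
Proof.
by apply: (iffP memv_imgP) => -[y Uy ->]; exists y => //; rewrite lfunE.
Qed.

Lemma bottom_spaceP (K : fieldType) (p q : nat) (U : {vspace 'cV[K]_q})
    (x : 'cV[K]_(p + q)) :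
  reflect (exists2 y, y \in U & x = col_mx 0 y) (x \in bottom_space p U).
Proof.
by apply: (iffP memv_imgP) => -[y Uy ->]; exists y => //; rewrite lfunE.
Qed.

Lemma directv_top_bottom (K : fieldType) (p q : nat)
    (U1 : {vspace 'cV[K]_p}) (U2 : {vspace 'cV[K]_q}) :
  directv (top_space q U1 + bottom_space p U2).
Proof.
apply/directv_addP/eqP; rewrite -subv0; apply/subvP => x.
rewrite memv_cap => /andP[/top_spaceP[y1 _ ->]].
by case/bottom_spaceP => y2 _ /eq_col_mx[-> _]; rewrite col_mx0 mem0v.
Qed.

Lemma mem_top_bottom (K : fieldType) (p q : nat)
    (U1 : {vspace 'cV[K]_p}) (U2 : {vspace 'cV[K]_q}) (x : 'cV[K]_(p + q)) :
  (x \in top_space q U1 + bottom_space p U2)%VS =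
  (usubmx x \in U1) && (dsubmx x \in U2).
Proof.
apply/memv_addP/andP.
  case=> _ /top_spaceP[y1 U1y1 ->] [_ /bottom_spaceP[y2 U2y2 ->] ->].
  by rewrite add_col_mx addr0 add0r col_mxKu col_mxKd.
case=> U1x U2x; exists (col_mx (usubmx x) 0).
  by apply/top_spaceP; exists (usubmx x).
exists (col_mx 0 (dsubmx x)).
  by apply/bottom_spaceP; exists (dsubmx x).
by rewrite add_col_mx addr0 add0r vsubmxK.
Qed.

(** * The reachable set *)

Lemma reachable0_sub (K : fieldType) (p q d : nat)
    (J : 'M[K]_p) (H : 'M[K]_q)
    (Bp : 'M[K]_(p, p + q)) (Bq : 'M[K]_(q, p + q)) (W : 'cV[K]_(p + q)) :
  H ^+ d = 0 -> reachable J H Bp Bq 0 W ->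
  (usubmx W \in krylov_space J Bp p) /\ (dsubmx W \in krylov_space H Bq d).
Proof.
move=> Hd0 [V [Y [sol Y0 [k <-]]]]; split.
  apply: (subvP (krylov_space_max J Bp k)); apply/krylov_spaceP.
  exists (fun i => V (k - i.+1)%N).
  apply: (proj1 (forward_recurrence J Bp V (fun j => usubmx (Y j)))).
  by split=> [|j]; [rewrite Y0 linear0 | case: (sol j)].
apply/krylov_spaceP; exists (fun i => - V (k + i)%N).
under eq_bigr do rewrite !mulmxN.
rewrite sumrN.
apply: (proj1 (backward_recurrence Bq V (fun j => dsubmx (Y j)) Hd0)) => j.
by case: (sol j).
Qed.

Lemma sub_reachable0 (K : fieldType) (p q d : nat)
    (J : 'M[K]_p) (H : 'M[K]_q)
    (Bp : 'M[K]_(p, p + q)) (Bq : 'M[K]_(q, p + q)) (W : 'cV[K]_(p + q)) :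
  H ^+ d = 0 ->
  usubmx W \in krylov_space J Bp p -> dsubmx W \in krylov_space H Bq d ->
  reachable J H Bp Bq 0 W.
Proof.
move=> Hd0 /krylov_spaceP[u Wu] /krylov_spaceP[w Ww].
(* The coefficient of J^i is the input applied i + 1 steps before the final
   time, so the steering window plays u backwards. *)
pose V j := if (j < d)%N then 0 else
            if (j < d + p)%N then u (d + p - j.+1)%N else - w (j - (d + p))%N.
pose yp k := \sum_(i < k) J ^+ i *m (Bp *m V (k - i.+1)%N).
pose yq k := - \sum_(i < d) H ^+ i *m (Bq *m V (k + i)%N).
have [yp0 ypS] : yp 0%N = 0 /\ forall k, yp k.+1 = J *m yp k + Bp *m V k.
  exact/forward_recurrence.
have yqS k : H *m yq k.+1 = yq k + Bq *m V k.
  exact: (proj2 (backward_recurrence Bq V yq Hd0)).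
have yq0 : yq 0%N = 0.
  rewrite /yq big1 ?oppr0 // => i _.
  by rewrite add0n /V ltn_ord !mulmx0.
have yp_end : yp (d + p)%N = usubmx W.
  rewrite Wu /yp addnC big_split_ord /= [X in _ + X]big1 ?addr0 => [|i _].
    apply: eq_bigr => i _; do 2!congr (_ *m _).
    have lt_ip := ltn_ord i.
    have le_d : (d <= p + d - i.+1)%N by rewrite addnC -addnBA // leq_addr.
    have lt_dp : (p + d - i.+1 < d + p)%N.
      by rewrite addnC ltn_subrL /= addn_gt0 (leq_trans _ lt_ip) ?orbT.
    rewrite /V ltnNge le_d lt_dp /=; congr (u _).
    rewrite [(p + d)%N]addnC -subSn ?(leq_trans lt_ip) ?leq_addl // subSS.
    by rewrite subKn // (leq_trans (ltnW lt_ip)) ?leq_addl.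
  rewrite /V -addnS subnDl.
  have lt_id := ltn_ord i.
  by rewrite ltn_subrL /= (leq_trans _ lt_id) // !mulmx0.
have yq_end : yq (d + p)%N = dsubmx W.
  rewrite Ww /yq -sumrN; apply: eq_bigr => i _.
  have /negbTE nlt_d : ~~ (d + p + i < d)%N by rewrite -leqNgt -addnA leq_addr.
  have /negbTE nlt_dp : ~~ (d + p + i < d + p)%N by rewrite -leqNgt leq_addr.
  by rewrite /V nlt_d nlt_dp addKn !mulmxN opprK.
exists V, (fun k => col_mx (yp k) (yq k)); split.
- by move=> k; rewrite !col_mxKu !col_mxKd.
- by rewrite yp0 yq0 col_mx0.
- by exists (d + p)%N; rewrite yp_end yq_end vsubmxK.
Qed.

Theorem theorem3p1 (K : fieldType) (p q qs : nat)
    (F G B P Q : 'M[K]_(p + q)) (J : 'M[K]_p) (H : 'M[K]_q) :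
  \det F = 0 ->
  regular_pencil F G ->
  weierstrass_form F G P Q J H ->
  index_of_annihilation H qs ->
  let Bp := usubmx (P *m B) in
  let Bq := dsubmx (P *m B) in
  let Sp : {vspace 'cV[K]_(p + q)} := top_space q (krylov_space J Bp p) in
  let Sq : {vspace 'cV[K]_(p + q)} := bottom_space p (krylov_space H Bq qs) in
  [/\ forall V X : nat -> 'cV[K]_(p + q),
        descriptor_solution F G B V X <->
        subsystems_solution J H Bp Bq V (fun k => invmx Q *m X k),
      directv (Sp + Sq)
    & forall W : 'cV[K]_(p + q),
        reachable J H Bp Bq 0 W <-> W \in (Sp + Sq)%VS].
Proof.
move=> _ _ form [_ Hqs0 _] Bp Bq Sp Sq; split.
- by move=> V X; apply: descriptor_solution_decoupled.
- exact: directv_top_bottom.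
- move=> W; rewrite mem_top_bottom; split.
    by case/(reachable0_sub Hqs0) => Wp Wq; apply/andP.
  by case/andP; apply: sub_reachable0 Hqs0.
Qed.
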